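(* Let $x>0$ be a real number, $d\ge 1$ an integer, and $r$ a nonzero real number with $r^2\neq x$. Let $g(t)=\frac{1}{t^2-x}$ and let $\{\mathcal{H}_n\}_{n\ge 0}$ be the sequence of Householder's method of order $d$ for $\sqrt{x}$ with starting point $r$: $$\mathcal{H}_0=r,\qquad \mathcal{H}_{n+1}=\mathcal{H}_n+d\,\frac{g^{(d-1)}(\mathcal{H}_n)}{g^{(d)}(\mathcal{H}_n)}\quad(n\ge 0).$$ Put $X=\frac{x+r^2}{x-r^2}$. (1) If $d$ is even, then for every $n\ge 0$, $$\mathcal{H}_n=r\,\frac{W_{\frac{(d+1)^n-1}{2}}(X)}{V_{\frac{(d+1)^n-1}{2}}(X)} \qquad\text{and}\qquad \mathcal{H}_n=r\prod_{k=1}^{\frac{(d+1)^n-1}{2}}\frac{X-\cos\left(\frac{2k\pi}{(d+1)^n}\right)}{X-\cos\left(\frac{(2k-1)\pi}{(d+1)^n}\right)}.$$ (2) If $d$ is odd, then for every $n\ge 1$, $$\mathcal{H}_n=r\,\frac{T_{\frac{(d+1)^n}{2}}(X)}{(X-1)\,U_{\frac{(d+1)^n}{2}-1}(X)} \qquad\text{and}\qquad \mathcal{H}_n=r\prod_{k=0}^{\frac{(d+1)^n}{2}-1}\frac{X-\cos\left(\frac{(2k+1)\pi}{(d+1)^n}\right)}{X-\cos\left(\frac{2k\pi}{(d+1)^n}\right)}.$$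
   Context: $g^{(m)}$ denotes the $m$-th derivative of $g$ ($g^{(0)}=g$). $T_k,U_k,V_k,W_k$ denote the Chebyshev polynomials of the first, second, third and fourth kind. All four families satisfy $P_{k+2}(X)=2XP_{k+1}(X)-P_k(X)$ for $k\ge 0$, with initial values $T_0=1,\ T_1=X$; $U_0=1,\ U_1=2X$; $V_0=1,\ V_1=2X-1$; $W_0=1,\ W_1=2X+1$. Empty products equal $1$. *)

(* Defs.v *)
From HB Require Import structures.
From mathcomp Require Import all_boot all_order all_algebra.
From mathcomp Require Import all_classical all_reals all_analysis.

Set Implicit Arguments.
Unset Strict Implicit.
Unset Printing Implicit Defensive.

Import Order.TTheory GRing.Theory Num.Theory.
Import numFieldNormedType.Exports.

Local Open Scope ring_scope.

Section Chebyshev.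
Variable R : realType.

Fixpoint chebyshev_rec (P0 P1 : {poly R}) (k : nat) : {poly R} :=
  match k with
  | 0%N => P0
  | k1.+1 =>
    match k1 with
    | 0%N => P1
    | k2.+1 =>
      2 *: 'X * chebyshev_rec P0 P1 k1 - chebyshev_rec P0 P1 k2
    end
  end.

Definition chebT : nat -> {poly R} := chebyshev_rec 1 'X.
Definition chebU : nat -> {poly R} := chebyshev_rec 1 (2 *: 'X).
Definition chebV : nat -> {poly R} := chebyshev_rec 1 (2 *: 'X - 1).
Definition chebW : nat -> {poly R} := chebyshev_rec 1 (2 *: 'X + 1).

End Chebyshev.

(* Here g plays the role of 1/f, f being the function whose zero is sought.
   Division is total, but for g(t) = 1/(t^2 - x) with x > 0, a nonzero starting
   point r with r^2 <> x and d >= 1, no iterate makes g^{(d)} vanish or hits a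
   pole of g. *)
Fixpoint householder (R : realType) (g : R -> R) (d : nat) (r : R) (n : nat)
    : R :=
  match n with
  | 0%N => r
  | m.+1 =>
    let h := householder g d r m in
    h + d%:R * (derive1n d.-1 g h / derive1n d g h)
  end.

(* Main.v *)
Require Import Defs.
From mathcomp Require Import all_boot all_order all_algebra.
From mathcomp Require Import all_classical all_reals all_analysis.
From mathcomp Require Import zify ring lra.
Import Order.TTheory GRing.Theory Num.Theory.
Import numFieldNormedType.Exports.
Local Open Scope ring_scope.

(** With [s = sqrt x], partial fractions give
    [2 s / (t^2 - x) = 1 / (t - s) - 1 / (t + s)], so every derivative of [g] is
    an explicit difference of two inverse powers ([derive1n_Vsub_sqr]).  Inserting
    these in one Householder step of order [d] and writing [a = h + s],
    [b = h - s], the new iterate is [s (a^D + b^D) / (a^D - b^D)] with [D = d + 1]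
    ([householder_step]).  In other words the Moebius coordinate
    [h |-> (h + s) / (h - s)] turns the iteration into the power map
    [z |-> z^D], whence the closed form with [N = D^n] ([householder_closed]).

    Put [q = - (r + s) / (r - s)].  Then [X = (q + 1/q) / 2], and at such a point
    the four Chebyshev families are combinations of powers of [q]
    (the lemmas [cheb*_joukowski]); the closed form above, a quotient of
    [q^N - 1] and [q^N + 1], is then recognised as [W/V] when [N] is odd and as
    [T / ((X - 1) U)] when [N] is even.

    The products come from the factorisation of the Chebyshev polynomials over
    their cosine roots (the lemmas [cheb*_prod]): numerator and denominator have
    the same degree and the same leading coefficient, so only the linear factors
    survive in the quotient.

    Both evaluations of a Chebyshev polynomial, at [cos t] and at
    [(q + 1/q) / 2], reduce to checking the recurrence
    [u (k+2) = 2 c u (k+1) - u k] for an explicit sequence [u], which is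
    [horner_chebyshev_rec]. *)

(** * Values of the Chebyshev polynomials *)

(** The weight [w] clears the denominator ([sin t], [cos (t / 2)], [q - 1], ...)
    of the usual closed forms, so that these hold with no side condition on the
    denominator. *)
Lemma horner_chebyshev_rec (R : realType) (P0 P1 : {poly R}) (c w : R)
    (u : nat -> R) :
  w * P0.[c] = u 0%N -> w * P1.[c] = u 1%N ->
  (forall k, u k.+2 = 2 * c * u k.+1 - u k) ->
  forall k, w * (chebyshev_rec P0 P1 k).[c] = u k.
Proof.
move=> u0 u1 uS k.
suff [] : w * (chebyshev_rec P0 P1 k).[c] = u k /\
          w * (chebyshev_rec P0 P1 k.+1).[c] = u k.+1 by [].
elim: k => [|k [IHk IHk1]]; first by [].
split=> //; rewrite uS -IHk -IHk1.
rewrite -[chebyshev_rec P0 P1 k.+2]/(2 *: 'X * chebyshev_rec P0 P1 k.+1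
  - chebyshev_rec P0 P1 k).
move: (chebyshev_rec P0 P1 k.+1) (chebyshev_rec P0 P1 k) => p q.
by rewrite hornerD hornerN hornerM hornerZ hornerX; ring.
Qed.

(** The phase [a] accounts for the closed forms starting at different angles:
    0 for T and half a step for V; likewise, for the sine, a full step for U and
    half a step for W. *)
Lemma cos_three_term (R : realType) (a t : R) (k : nat) :
  cos (a + k.+2%:R * t) = 2 * cos t * cos (a + k.+1%:R * t) - cos (a + k%:R * t).
Proof.
have -> : a + k.+2%:R * t = a + k.+1%:R * t + t by rewrite -natr1; ring.
have -> : a + k%:R * t = a + k.+1%:R * t - t by rewrite -natr1; ring.
by rewrite cosD cosB; ring.
Qed.

Lemma sin_three_term (R : realType) (a t : R) (k : nat) :
  sin (a + k.+2%:R * t) = 2 * cos t * sin (a + k.+1%:R * t) - sin (a + k%:R * t).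
Proof.
have -> : a + k.+2%:R * t = a + k.+1%:R * t + t by rewrite -natr1; ring.
have -> : a + k%:R * t = a + k.+1%:R * t - t by rewrite -natr1; ring.
by rewrite sinD sinB; ring.
Qed.

Lemma chebT_cos (R : realType) (t : R) (k : nat) :
  (chebT R k).[cos t] = cos (k%:R * t).
Proof.
rewrite -[LHS]mul1r -[k%:R * t]add0r.
apply: (@horner_chebyshev_rec _ _ _ _ _ (fun k => cos (0 + k%:R * t))) => [||{}k].
- by rewrite !hornerE ?mul0r ?add0r ?cos0.
- by rewrite !hornerE ?add0r ?mul1r.
- exact: cos_three_term.
Qed.

Lemma chebU_cos (R : realType) (t : R) (k : nat) :
  sin t * (chebU R k).[cos t] = sin (k.+1%:R * t).
Proof.
have -> : k.+1%:R * t = t + k%:R * t by rewrite -natr1; ring.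
apply: (@horner_chebyshev_rec _ _ _ _ _ (fun k => sin (t + k%:R * t))) => [||{}k].
- by rewrite !hornerE ?mul0r ?addr0.
- by rewrite hornerZ hornerX mul1r sinD; ring.
- exact: sin_three_term.
Qed.

(** Families V and W live at the half angle: [t] is half of the argument of the
    cosine at which the polynomial is evaluated. *)
Lemma chebV_cos (R : realType) (t : R) (k : nat) :
  cos t * (chebV R k).[cos (2 * t)] = cos ((2 * k + 1)%:R * t).
Proof.
have -> : (2 * k + 1)%:R * t = t + k%:R * (2 * t) by rewrite natrD natrM; ring.
apply: (@horner_chebyshev_rec _ _ _ _ _ (fun k => cos (t + k%:R * (2 * t))))
  => [||{}k].
- by rewrite !hornerE ?mul0r ?addr0.
- rewrite hornerD ?hornerN hornerZ hornerX -polyC1 hornerC mul1r.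
  rewrite cosD (mulr_natl t 2) cos_mulr2n sin_mulr2n.
  by ring: (sin2cos2 t).
- exact: cos_three_term.
Qed.

Lemma chebW_cos (R : realType) (t : R) (k : nat) :
  sin t * (chebW R k).[cos (2 * t)] = sin ((2 * k + 1)%:R * t).
Proof.
have -> : (2 * k + 1)%:R * t = t + k%:R * (2 * t) by rewrite natrD natrM; ring.
apply: (@horner_chebyshev_rec _ _ _ _ _ (fun k => sin (t + k%:R * (2 * t))))
  => [||{}k].
- by rewrite !hornerE ?mul0r ?addr0.
- rewrite hornerD ?hornerN hornerZ hornerX -polyC1 hornerC mul1r.
  rewrite sinD (mulr_natl t 2) cos_mulr2n sin_mulr2n.
  by ring.
- exact: sin_three_term.
Qed.

(** The complex identity [cos t = (q + 1/q) / 2] with [q = exp (i t)] becomes a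
    rational one, valid for real [q]; this reaches the points outside [-1, 1],
    where [X] lies. *)
Lemma chebT_joukowski (R : realType) (q : R) (m : nat) : q != 0 ->
  (chebT R m).[(q + q^-1) / 2] = (q ^+ m + q ^- m) / 2.
Proof.
move=> q0; rewrite -[LHS]mul1r.
apply: (@horner_chebyshev_rec _ _ _ _ _ (fun m => (q ^+ m + q ^- m) / 2)) => [||{}m].
- by rewrite hornerC expr0; field.
- by rewrite hornerX; field.
- rewrite !exprS; have := expf_neq0 m q0; move: (q ^+ m) => p p0.
  by field; rewrite p0 q0.
Qed.

Lemma chebU_joukowski (R : realType) (q : R) (m : nat) : q != 0 ->
  (q - q^-1) * (chebU R m).[(q + q^-1) / 2] = q ^+ m.+1 - q ^- m.+1.
Proof.
move=> q0.
apply: (@horner_chebyshev_rec _ _ _ _ _ (fun m => q ^+ m.+1 - q ^- m.+1)) => [||{}m].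
- by rewrite hornerC mulr1.
- by rewrite hornerZ hornerX; field.
- rewrite !exprS; have := expf_neq0 m q0; move: (q ^+ m) => p p0.
  by field; rewrite p0 q0.
Qed.

Lemma chebV_joukowski (R : realType) (q : R) (m : nat) : q != 0 ->
  (q + 1) * (chebV R m).[(q + q^-1) / 2] = q ^+ m.+1 + q ^- m.
Proof.
move=> q0.
apply: (@horner_chebyshev_rec _ _ _ _ _ (fun m => q ^+ m.+1 + q ^- m)) => [||{}m].
- by rewrite hornerC expr0 invr1 mulr1.
- by rewrite hornerD hornerN hornerZ hornerX -polyC1 hornerC; field.
- rewrite !exprS; have := expf_neq0 m q0; move: (q ^+ m) => p p0.
  by field; rewrite p0 q0.
Qed.

Lemma chebW_joukowski (R : realType) (q : R) (m : nat) : q != 0 ->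
  (q - 1) * (chebW R m).[(q + q^-1) / 2] = q ^+ m.+1 - q ^- m.
Proof.
move=> q0.
apply: (@horner_chebyshev_rec _ _ _ _ _ (fun m => q ^+ m.+1 - q ^- m)) => [||{}m].
- by rewrite hornerC expr0 invr1 mulr1.
- by rewrite hornerD hornerZ hornerX -polyC1 hornerC; field.
- rewrite !exprS; have := expf_neq0 m q0; move: (q ^+ m) => p p0.
  by field; rewrite p0 q0.
Qed.

(** * Factorisation over the cosine roots *)

(** Each recurrence step multiplies the top coefficient by 2, as the
    subtracted polynomial has smaller degree. *)
Lemma size_lead_chebyshev_rec (R : realType) (P1 : {poly R}) (k : nat) :
  size P1 = 2%N ->
  size (chebyshev_rec 1 P1 k.+1) = k.+2 /\
  lead_coef (chebyshev_rec 1 P1 k.+1) = 2 ^+ k * lead_coef P1.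
Proof.
move=> sP1.
suff [_] : (size (chebyshev_rec 1 P1 k) <= k.+1)%N /\
  (size (chebyshev_rec 1 P1 k.+1) = k.+2 /\
   lead_coef (chebyshev_rec 1 P1 k.+1) = 2 ^+ k * lead_coef P1) by [].
elim: k => [|k [sk [sk1 lk1]]].
  by rewrite size_poly1 expr0 mul1r.
split; first by rewrite sk1.
rewrite -[chebyshev_rec 1 P1 k.+2]/(2 *: 'X * chebyshev_rec 1 P1 k.+1
  - chebyshev_rec 1 P1 k).
set p := chebyshev_rec 1 P1 k.+1 in sk1 lk1 *; set q := chebyshev_rec 1 P1 k in sk *.
have pn0 : p != 0 by rewrite -size_poly_gt0 sk1.
have two0 : 2 != 0 :> R by rewrite pnatr_eq0.
have E : 2 *: 'X * p = 2 *: (p * 'X) by rewrite -scalerAl mulrC.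
have sX : size (2 *: 'X * p) = k.+3 by rewrite E size_scale // size_mulX // sk1.
have lt_q : (size (- q)%R < size (2 *: 'X * p)%R)%N.
  by rewrite size_polyN sX (leq_ltn_trans sk) // leqW.
rewrite size_polyDl // lead_coefDl // sX; split=> //.
by rewrite E lead_coefZ lead_coefMX lk1 exprS mulrA.
Qed.

(** The cases [c = 0], [-1] and [1] are the families U, V and W. *)
Lemma size_lead_chebyshev_rec_affine (R : realType) (c : R) (m : nat) :
  size (chebyshev_rec 1 (2 *: 'X + c%:P) m) = m.+1 /\
  lead_coef (chebyshev_rec 1 (2 *: 'X + c%:P) m) = 2 ^+ m.
Proof.
case: m => [|m]; first by rewrite size_poly1 lead_coef1.
have s2X : size (2 *: 'X : {poly R}) = 2%N.
  by rewrite size_scale ?size_polyX // pnatr_eq0.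
have sc : (size c%:P < size (2 *: 'X : {poly R})%R)%N.
  by rewrite s2X (leq_ltn_trans (size_polyC_leq1 c)).
have sP : size (2 *: 'X + c%:P) = 2%N by rewrite size_polyDl.
have [-> ->] := size_lead_chebyshev_rec R _ m sP.
by rewrite lead_coefDl // lead_coefZ lead_coefX mulr1 -exprSr.
Qed.

Lemma sin_natpi (R : realType) (k : nat) : sin (k%:R * pi) = 0 :> R.
Proof.
elim: k => [|k IH]; first by rewrite mul0r sin0.
by rewrite -natr1 mulrDl mul1r sinDpi IH oppr0.
Qed.

Lemma cos_odd_pihalf (R : realType) (k : nat) :
  cos ((2 * k + 1)%:R * (pi / 2)) = 0 :> R.
Proof.
have -> : (2 * k + 1)%:R * (pi / 2) = k%:R * pi + pi / 2 :> R.
  by rewrite natrD natrM; field.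
by rewrite cosDpihalf sin_natpi oppr0.
Qed.

(** Since cosine is injective on [[0, pi]], the listed roots are distinct; as
    they are as many as the degree, they are all the roots. *)
Lemma horner_prod_cos_roots (R : realType) (p : {poly R}) (i j N : nat)
    (c : nat -> nat) (y : R) :
  size p = (j - i).+1 -> (0 < N)%N -> injective c ->
  (forall k, (i <= k < j)%N -> (c k <= N)%N /\
     root p (cos ((c k)%:R * pi / N%:R))) ->
  p.[y] = lead_coef p * \prod_(i <= k < j) (y - cos ((c k)%:R * pi / N%:R)).
Proof.
move=> sp N0 cinj cP.
pose f k : R := cos ((c k)%:R * pi / N%:R).
have Nr0 : 0 < N%:R :> R by rewrite ltr0n.
have ang k : (i <= k < j)%N -> (c k)%:R * pi / N%:R \in `[0, pi : R].
  move=> /cP[ck _]; rewrite in_itv /= divr_ge0 ?mulr_ge0 ?pi_ge0 ?ler0n //=.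
  by rewrite ler_pdivrMr // mulrC ler_wpM2l ?pi_ge0 // ler_nat.
have finj : {in index_iota i j &, injective f}.
  move=> k l; rewrite !mem_index_iota => kP lP /cos_inj.
  move=> /(_ (ang _ kP) (ang _ lP)) /(congr1 (fun z => z * N%:R / pi)).
  rewrite !divfK ?gt_eqF// !mulfK ?gt_eqF ?pi_gt0 // => /eqP.
  by rewrite eqr_nat => /eqP/cinj.
rewrite {1}(@all_roots_prod_XsubC _ p [seq f k | k <- index_iota i j]).
- rewrite hornerZ big_map horner_prod; congr (_ * _).
  by apply: eq_bigr => k _; rewrite !hornerE.
- by rewrite size_map size_iota.
- by apply/allP => z /mapP[k]; rewrite mem_index_iota => /cP[_ kr] ->.
- by rewrite uniq_rootsE map_inj_in_uniq // iota_uniq.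
Qed.

Lemma chebT_prod (R : realType) (m : nat) (y : R) : (0 < m)%N ->
  (chebT R m).[y] = 2 ^+ (m - 1) *
  \prod_(0 <= k < m) (y - cos ((2 * k + 1)%:R * pi / (2 * m)%:R)).
Proof.
move=> m0; have m20 : m%:R != 0 :> R by rewrite pnatr_eq0 -lt0n.
have [sT lT] := @size_lead_chebyshev_rec R 'X m.-1 (size_polyX R).
rewrite prednK // in sT lT; rewrite lead_coefX mulr1 in lT.
rewrite (@horner_prod_cos_roots _ _ 0 m (2 * m) (fun k => (2 * k + 1)%N)).
- by rewrite [lead_coef _]lT subn1.
- by rewrite subn0.
- lia.
- by move=> k l; lia.
move=> k /andP[_ km]; split; first lia.
rewrite rootE chebT_cos -(cos_odd_pihalf R k); apply/eqP; congr cos.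
by rewrite natrM; field.
Qed.

(** The factor [y - 1] supplies the root [cos 0], which makes the index range
    and the leading coefficient agree with those of T in [chebT_prod]. *)
Lemma chebU_prod (R : realType) (m : nat) (y : R) : (0 < m)%N ->
  (y - 1) * (chebU R (m - 1)).[y] = 2 ^+ (m - 1) *
  \prod_(0 <= k < m) (y - cos ((2 * k)%:R * pi / (2 * m)%:R)).
Proof.
case: m => // m _.
rewrite subn1 [m.+1.-1]/= big_ltn // muln0 !mul0r cos0 mulrCA; congr (_ * _).
have [sU lU] := size_lead_chebyshev_rec_affine R 0 m.
rewrite addr0 -/(chebU R) in sU lU.
have M0 : m.+1%:R != 0 :> R by rewrite pnatr_eq0.
rewrite (horner_prod_cos_roots R _ 1 m.+1 (2 * m.+1) (fun k => (2 * k)%N)).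
- by rewrite lU.
- by rewrite subn1.
- lia.
- by move=> k l; lia.
move=> k /andP[k0 km]; split; first lia.
set t := _ / _; have Et : t = k%:R * pi / m.+1%:R.
  by rewrite /t !natrM; field; rewrite ?nat1r ?natr1.
have t0 : sin t != 0.
  rewrite gt_eqF // sin_gt0_pi // Et divr_gt0 ?mulr_gt0 ?pi_gt0 ?ltr0n //=.
  by rewrite ltr_pdivrMr ?ltr0n // mulrC ltr_pM2l ?pi_gt0 // ltr_nat.
rewrite rootE -(mulrI_eq0 _ (mulfI t0)) chebU_cos -(sin_natpi R k).
apply/eqP; congr sin.
by rewrite Et; field; rewrite ?nat1r ?natr1.
Qed.

Lemma chebV_prod (R : realType) (m : nat) (y : R) :
  (chebV R m).[y] = 2 ^+ m *
  \prod_(1 <= k < m.+1) (y - cos ((2 * k - 1)%:R * pi / (2 * m + 1)%:R)).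
Proof.
have [sV lV] := size_lead_chebyshev_rec_affine R (-1) m.
rewrite polyCN -/(chebV R) in sV lV.
have N0 : (2 * m + 1)%:R != 0 :> R by rewrite addn1 pnatr_eq0.
rewrite (horner_prod_cos_roots R _ 1 m.+1 (2 * m + 1) (fun k => (2 * k - 1)%N)).
- by rewrite lV.
- by rewrite subn1.
- lia.
- by move=> k l; lia.
move=> k /andP[k0 km]; split; first lia.
set t := _ / _; have -> : t = 2 * (t / 2) by field.
have t0 : cos (t / 2) != 0.
  have tge0 : 0 <= t by rewrite divr_ge0 ?mulr_ge0 ?pi_ge0 ?ler0n.
  have tlt : t < pi.
    rewrite ltr_pdivrMr ?ltr0n ?addn1 // mulrC ltr_pM2l ?pi_gt0 // ltr_nat.
    by lia.
  by rewrite gt_eqF // cos_gt0_pihalf //; have := pi_gt0 R; lra.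
rewrite rootE -(mulrI_eq0 _ (mulfI t0)) chebV_cos -(cos_odd_pihalf R k.-1).
apply/eqP; congr cos.
have -> : (2 * k.-1 + 1)%N = (2 * k - 1)%N by lia.
by rewrite /t; field.
Qed.

Lemma chebW_prod (R : realType) (m : nat) (y : R) :
  (chebW R m).[y] = 2 ^+ m *
  \prod_(1 <= k < m.+1) (y - cos ((2 * k)%:R * pi / (2 * m + 1)%:R)).
Proof.
have [sW lW] := size_lead_chebyshev_rec_affine R 1 m.
rewrite -/(chebW R) in sW lW.
have N0 : (2 * m + 1)%:R != 0 :> R by rewrite addn1 pnatr_eq0.
rewrite (horner_prod_cos_roots R _ 1 m.+1 (2 * m + 1) (fun k => (2 * k)%N)).
- by rewrite lW.
- by rewrite subn1.
- lia.
- by move=> k l; lia.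
move=> k /andP[k0 km]; split; first lia.
set t := _ / _; have -> : t = 2 * (t / 2) by field.
have t0 : sin (t / 2) != 0.
  have tgt0 : 0 < t by rewrite divr_gt0 ?mulr_gt0 ?pi_gt0 ?ltr0n ?muln_gt0 ?addn1.
  have tle : t <= pi.
    rewrite ler_pdivrMr ?ltr0n ?addn1 // mulrC ler_pM2l ?pi_gt0 // ler_nat.
    by lia.
  by rewrite gt_eqF // sin_gt0_pi //; have := pi_gt0 R; lra.
rewrite rootE -(mulrI_eq0 _ (mulfI t0)) chebW_cos -(sin_natpi R k).
apply/eqP; congr sin.
by rewrite /t natrM; field.
Qed.

(** * Householder iteration for the square root *)

Lemma is_derive_shift_Vpow (R : realType) (a t : R) (k : nat) :
  t != a ->
  is_derive t 1 (fun y => (y - a) ^- k.+1 : R) (- k.+1%:R * (t - a) ^- k.+2).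
Proof.
move=> ta; have ta0 : t - a != 0 by rewrite subr_eq0.
have D : is_derive t 1 ((fun y : R => y - a) ^+ k.+1)
    ((k.+1%:R * (t - a) ^+ k) *: (1 : R)).
  by apply: is_deriveX; exact: is_derive_shift.
have fn0 : ((fun y : R => y - a) ^+ k.+1) t != 0 by rewrite exprfctE expf_neq0.
have := is_deriveV fn0 D.
set l := (X in is_derive _ _ _ X).
have -> : l = - k.+1%:R * (t - a) ^- k.+2.
  rewrite /l exprfctE /GRing.scale /= !exprS.
  by field; rewrite ?expf_neq0 ?ta0.
by rewrite exprfctE.
Qed.

(** Partial fractions, differentiated termwise.  The induction needs the formula
    for all [t] away from the poles, as differentiating once more uses it on a
    neighbourhood. *)
Lemma derive1n_Vsub_sqr (R : realType) (s t : R) (k : nat) :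
  s != 0 -> t != s -> t != - s ->
  derive1n k (fun y : R => 1 / (y ^+ 2 - s ^+ 2)) t =
  (-1) ^+ k * k`!%:R / (2 * s) * ((t - s) ^- k.+1 - (t + s) ^- k.+1).
Proof.
move=> s0; elim: k t => [|k IH] t ts tNs.
  rewrite derive1n0 fact0 subr_sqr.
  field.
  by rewrite s0 !(subr_eq0, addr_eq0) ts tNs.
rewrite derive1nS derive1E.
set F : R -> R := fun y =>
  (-1) ^+ k * k`!%:R / (2 * s) *: ((y - s) ^- k.+1 - (y - (- s)) ^- k.+1).
have near_neq (a : R) : t != a -> \near t, t != a.
  by move=> ta; apply: open_nbhs_nbhs; split=> //; exact: open_neq.
rewrite (@near_eq_derive _ _ _ _ F); last first.
  by near=> y; rewrite IH ?/F ?opprK//; near: y; exact: near_neq.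
have D : is_derive t (1 : R) F ((-1) ^+ k * k`!%:R / (2 * s) *:
   (- k.+1%:R * (t - s) ^- k.+2 - - k.+1%:R * (t - - s) ^- k.+2)).
  apply: is_deriveZ; apply: is_deriveB; exact: is_derive_shift_Vpow.
rewrite derive_val opprK -[_ *: _]/(_ * _) factS natrM.
move: ((t - s) ^- k.+2) ((t + s) ^- k.+2) => u v; rewrite exprS.
by ring.
Unshelve. all: by end_near. Qed.

(** As [r + s] and [r - s] differ in absolute value, so do their powers; this
    keeps every denominator of the iteration away from 0. *)
Lemma expr_addsub_neq (R : realType) (r s : R) (N : nat) :
  r != 0 -> s != 0 -> (0 < N)%N -> (r + s) ^+ N != (r - s) ^+ N.
Proof.
move=> r0 s0 N0; apply/eqP => /(congr1 Num.norm); rewrite !normrX => /eqP.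
rewrite eqrXn2 ?normr_ge0 // => /eqP /(congr1 (fun z => z ^+ 2)).
rewrite !real_normK ?num_real // => E.
have /eqP : r * s = 0 by lra.
by rewrite mulf_eq0 (negbTE r0) (negbTE s0).
Qed.

(** With [a = h + s] and [b = h - s], the correction term equals
    [- a b (a^d - b^d) / (a^(d+1) - b^(d+1))], and the identities [h = b + s = a - s]
    make the sum with [h] collapse. *)
Lemma householder_step (R : realType) (s h : R) (d : nat) :
  s != 0 -> h != s -> h != - s -> (0 < d)%N ->
  (h + s) ^+ (d + 1) != (h - s) ^+ (d + 1) ->
  let g := fun t : R => 1 / (t ^+ 2 - s ^+ 2) in
  h + d%:R * (derive1n d.-1 g h / derive1n d g h) =
  s * (((h + s) ^+ (d + 1) + (h - s) ^+ (d + 1)) /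
       ((h + s) ^+ (d + 1) - (h - s) ^+ (d + 1))).
Proof.
case: d => // d s0 hs hNs _; rewrite addn1 => neq g.
rewrite !derive1n_Vsub_sqr // [d.+1.-1]/=.
have a0 : h + s != 0 by rewrite addr_eq0.
have b0 : h - s != 0 by rewrite subr_eq0.
move: neq; rewrite -subr_eq0.
have Eh : h = ((h + s) + (h - s)) / 2 by field.
have Es : s = ((h + s) - (h - s)) / 2 by field.
move: Eh Es a0 b0; move: (h + s) (h - s) => a b Eh Es a0 b0.
rewrite !exprS factS natrM => neq.
rewrite [X in X + _]Eh.
have f0 : d`!%:R != 0 :> R by rewrite pnatr_eq0 -lt0n fact_gt0.
have d0 : d.+1%:R != 0 :> R by rewrite pnatr_eq0.
have := expf_neq0 d a0; have := expf_neq0 d b0.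
have : (-1) ^+ d != 0 :> R by rewrite signr_eq0.
move: neq; move: (a ^+ d) (b ^+ d) ((-1) ^+ d) => P Q e neq e0 Q0 P0.
have -> : e * d`!%:R / (2 * s) * ((b * Q)^-1 - (a * P)^-1)
    = e * d`!%:R / (2 * s) * ((a * P - b * Q) / (a * b * P * Q)).
  by field; rewrite s0 a0 b0 P0 Q0.
have -> : -1 * e * (d.+1%:R * d`!%:R) / (2 * s) *
    ((b * (b * Q))^-1 - (a * (a * P))^-1)
    = - (e * d.+1%:R * d`!%:R / (2 * s)) *
      ((a * (a * P) - b * (b * Q)) / (a ^+ 2 * b ^+ 2 * P * Q)).
  by field; rewrite s0 a0 b0 P0 Q0.
rewrite [X in _ = X * _]Es.
by field; rewrite neq s0 a0 b0 P0 Q0 f0 ?nat1r ?natr1 d0 e0.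
Qed.

(** If [h = s (P + Q) / (P - Q)] then [h + s] and [h - s] are [w P] and [w Q] for
    one [w]: a step raises [P] and [Q] to the power [d + 1] and loses [w]. *)
Lemma householder_closed (R : realType) (s r : R) (d n : nat) :
  s != 0 -> r != 0 -> r ^+ 2 != s ^+ 2 -> (0 < d)%N ->
  let N := ((d + 1) ^ n)%N in
  householder (fun t : R => 1 / (t ^+ 2 - s ^+ 2)) d r n =
  s * (((r + s) ^+ N + (r - s) ^+ N) / ((r + s) ^+ N - (r - s) ^+ N)).
Proof.
move=> s0 r0; rewrite -subr_eq0 subr_sqr mulf_eq0 negb_or => /andP[b0 a0] d0.
elim: n => [|n IH] /=.
  rewrite expn0 !expr1; field.
  have -> : r + s - (r - s) = s *+ 2 by ring.
  by rewrite mulrn_eq0.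
have N0 m : (0 < (d + 1) ^ m)%N by rewrite expn_gt0 addn1.
have := @expr_addsub_neq _ _ _ _ r0 s0 (N0 n.+1).
have := @expr_addsub_neq _ _ _ _ r0 s0 (N0 n).
rewrite {}IH expnSr !exprM.
have := expf_neq0 ((d + 1) ^ n) a0; have := expf_neq0 ((d + 1) ^ n) b0.
move: ((r + s) ^+ ((d + 1) ^ n)) ((r - s) ^+ ((d + 1) ^ n)) => P Q Q0 P0.
rewrite -subr_eq0 => PQ; rewrite -subr_eq0 => PQD.
set h := s * _; pose w := 2 * s / (P - Q).
have w0 : w != 0 by rewrite !mulf_neq0 ?invr_eq0 ?pnatr_eq0.
have hD : h + s = w * P by rewrite /h /w; field.
have hB : h - s = w * Q by rewrite /h /w; field.
clearbody w; rewrite householder_step //.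
- rewrite hD hB !exprMn; have := expf_neq0 (d + 1) w0.
  move: PQD; move: (w ^+ _) (P ^+ _) (Q ^+ _) => W P' Q' PQD W0.
  have WPQ : W * P' - W * Q' != 0 by rewrite -mulrBr mulf_neq0.
  by field; rewrite ?PQD ?WPQ.
- by rewrite -subr_eq0 hB mulf_neq0.
- by rewrite -subr_eq0 opprK hD mulf_neq0.
- by rewrite hD hB !exprMn -subr_eq0 -mulrBr mulf_neq0 ?expf_neq0.
Qed.

(** * The iterates as quotients of Chebyshev polynomials *)

Theorem theorem9 (R : realType) (x : R) (d : nat) (r : R)
    (hx : 0 < x) (hd : (1 <= d)%N) (hr : r != 0) (hrx : r ^+ 2 != x) :
  let g := fun t : R => 1 / (t ^+ 2 - x) in
  let H := householder g d r in
  let X := (x + r ^+ 2) / (x - r ^+ 2) in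
  (~~ odd d -> forall n : nat,
    let m := (((d + 1) ^ n - 1) %/ 2)%N in
    H n = r * ((chebW R m).[X] / (chebV R m).[X]) /\
    H n = r * \prod_(1 <= k < m.+1)
      ((X - cos ((2 * k)%:R * pi / ((d + 1) ^ n)%:R)) /
       (X - cos ((2 * k - 1)%:R * pi / ((d + 1) ^ n)%:R))))
  /\
  (odd d -> forall n : nat, (1 <= n)%N ->
    let m := ((d + 1) ^ n %/ 2)%N in
    H n = r * ((chebT R m).[X] / ((X - 1) * (chebU R (m - 1)).[X])) /\
    H n = r * \prod_(0 <= k < m)
      ((X - cos ((2 * k + 1)%:R * pi / ((d + 1) ^ n)%:R)) /
       (X - cos ((2 * k)%:R * pi / ((d + 1) ^ n)%:R)))).
Proof.
have [s s0 Ex] : exists2 s, 0 < s & x = s ^+ 2.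
  by exists (Num.sqrt x); rewrite ?sqrtr_gt0 // sqr_sqrtr // ltW.
rewrite {x hx}Ex in hrx * => g H X.
have {}s0 : s != 0 by rewrite gt_eqF.
have := hrx; rewrite -subr_eq0 subr_sqr mulf_eq0 negb_or => /andP[b0 a0].
have rs0 : s ^+ 2 - r ^+ 2 != 0 by rewrite subr_eq0 eq_sym.
pose q := - ((r + s) / (r - s)).
have q0 : q != 0 by rewrite oppr_eq0 mulf_neq0 ?invr_eq0.
have q1 : q + 1 != 0.
  have -> : q + 1 = - (2 * s) / (r - s) by rewrite /q; field.
  by rewrite !mulf_neq0 ?invr_eq0 ?oppr_eq0 ?mulf_neq0 ?pnatr_eq0.
have qN1 : q - 1 != 0.
  have -> : q - 1 = - (2 * r) / (r - s) by rewrite /q; field.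
  by rewrite !mulf_neq0 ?invr_eq0 ?oppr_eq0 ?mulf_neq0 ?pnatr_eq0.
(* The factor [(q + 1) / (q - 1)] left over by the weights of the Chebyshev
   values is what changes the prefactor [s] into [r]. *)
have Es : s = r * (q + 1) / (q - 1).
  have -> : q + 1 = - (2 * s) / (r - s) by rewrite /q; field.
  have -> : q - 1 = - (2 * r) / (r - s) by rewrite /q; field.
  by field; rewrite hr b0.
have XE : X = (q + q^-1) / 2.
  by rewrite /X /q; field; rewrite a0 b0 rs0.
have N0 n : (0 < (d + 1) ^ n)%N by rewrite expn_gt0 addn1.
have HE n := @householder_closed _ _ _ d n s0 hr hrx hd.
have PQ n := @expr_addsub_neq _ _ _ _ hr s0 (N0 n).
have PE n : (r + s) ^+ ((d + 1) ^ n) =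
    (-1) ^+ odd ((d + 1) ^ n) * q ^+ ((d + 1) ^ n) * (r - s) ^+ ((d + 1) ^ n).
  by rewrite signr_odd -!exprMn; congr (_ ^+ _); rewrite /q; field.
(* An opaque [q] stays atomic in the field computations below. *)
clearbody q.
have Q0 n := expf_neq0 ((d + 1) ^ n) b0.
split=> [d_even n m|d_odd n n1 m].
- have oN : odd ((d + 1) ^ n) by rewrite oddX oddD (negbTE d_even) orbT.
  have EN : ((d + 1) ^ n = 2 * m + 1)%N.
    by rewrite /m; move: (N0 n) oN; move: ((d + 1) ^ n)%N; clear; lia.
  have {}HE : H n = r * ((chebW R m).[X] / (chebV R m).[X]).
    rewrite /H /g HE XE; move: (PQ n) (Q0 n); rewrite PE oN expr1 EN.
    rewrite addn1 exprS mulnC exprM.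
    have := chebV_joukowski _ _ m q0; have := chebW_joukowski _ _ m q0.
    rewrite exprS; have := @expf_neq0 _ _ m q0.
    move: (q ^+ m) ((r - s) ^+ _) (chebV R m).[_] (chebW R m).[_].
    move=> p Q v w p0 Ew Ev neq Qn0.
    have {}Ev : v = (q * p + p^-1) / (q + 1) by rewrite -Ev mulrC mulKf.
    have {}Ew : w = (q * p - p^-1) / (q - 1) by rewrite -Ew mulrC mulKf.
    (* [q p^2 = q^N], and [q^N = -1] would force [(r + s)^N = (r - s)^N]. *)
    have n0 : q * p ^+ 2 + 1 != 0.
      by rewrite addr_eq0; apply: contra neq => /eqP ->; rewrite mulN1r opprK mul1r.
    rewrite Ev Ew [X in X * _]Es; field.
    by rewrite -mulrA -expr2 q1 p0 n0 qN1 subr_eq0.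
  split=> //; rewrite HE chebW_prod chebV_prod EN prodf_div.
  by rewrite -mulf_div divff ?mul1r // expf_neq0 // pnatr_eq0.
- have eN : ~~ odd ((d + 1) ^ n) by rewrite oddX oddD d_odd orbF -lt0n n1.
  have EN : ((d + 1) ^ n = 2 * m)%N.
    by rewrite /m; move: eN; move: ((d + 1) ^ n)%N; clear; lia.
  have m0 : (0 < m)%N by move: (N0 n); rewrite EN muln_gt0.
  have {}HE : H n = r * ((chebT R m).[X] / ((X - 1) * (chebU R (m - 1)).[X])).
    rewrite /H /g HE XE; move: (PQ n) (Q0 n); rewrite PE (negbTE eN) mul1r EN.
    rewrite mulnC exprM chebT_joukowski //.
    have := chebU_joukowski _ _ (m - 1) q0; rewrite subn1 prednK //.
    have := @expf_neq0 _ _ m q0.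
    move: (q ^+ m) ((r - s) ^+ _) (chebU R _).[_].
    move=> p Q u p0 Eu neq Qn0.
    have qV0 : q - q^-1 != 0.
      have -> : q - q^-1 = (q + 1) * (q - 1) / q by field.
      by rewrite !mulf_neq0 ?invr_eq0.
    have {}Eu : u = (p - p^-1) / (q - q^-1) by rewrite -Eu mulrC mulKf.
    (* Here [p^2 = q^N]. *)
    have n0 : p ^+ 2 - 1 != 0.
      by rewrite subr_eq0; apply: contra neq => /eqP ->; rewrite mul1r.
    rewrite Eu [X in X * _]Es; field.
    have qq1 : q * q - 1 != 0.
      by rewrite (_ : _ - 1 = (q + 1) * (q - 1)) ?mulf_neq0 //; ring.
    have qq2 : q * q + 1 + -1 * (q * 2) != 0.
      by rewrite (_ : _ + _ = (q - 1) * (q - 1)) ?mulf_neq0 //; ring.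
    have pp : p * p - 1 != 0 by rewrite -expr2.
    have PQ0 : p ^+ 2 * Q - Q != 0 by rewrite subr_eq0.
    by rewrite q0 qq1 p0 pp qq2 PQ0 qN1.
  split=> //; rewrite HE chebT_prod // chebU_prod // EN prodf_div.
  by rewrite -mulf_div divff ?mul1r // expf_neq0 // pnatr_eq0.
Qed.
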